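(* For any integer $k\ge2$ and any $1<p<\infty$, the sequence $(k^n)_{n\ge1}$ is ultimately bad in $L^p$.
   Context: For a function $f$ on a measure space $(X,\mu)$, $\|f\|_{p,\infty}=\sup_{y>0}y\cdot\mu\{x:|f(x)|\ge y\}^{1/p}$. For a sequence $w=(w_t)_{t\in\mathbb N}$ of positive reals and $1<p<\infty$, $C_p(w)=\|w\|_{p,\infty}=\sup_{y>0}y\cdot|\{t:w_t\ge y\}|^{1/p}$. A sequence $(a_n)$ of real numbers (respectively integers) is called ultimately bad in $L^p$ if for any aperiodic measure-preserving flow $(T^t)_{t\in\mathbb R}$ (respectively any aperiodic measure-preserving transformation $T$) of a probability space and every sequence $(w_t)$ of positive reals with $C_p(w)=\infty$, there is no constant $C>0$ such that $\big\|\sup_tw_t2^{-t}\sum_{n\le2^t}f(T^{a_n}x)\big\|_{p,\infty}\le C\|f\|_p$ for all $f\in L^p$. A transformation $T$ is aperiodic if $\mu\{x:T^nx=x\text{ for some }n\ge1\}=0$; a flow is aperiodic if $\mu\{x:T^tx=x\text{ for some }t\ne0\}=0$.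
   Formalization: The probability space is assumed to have countably many measurable sets separating points up to a null set (true of Lebesgue spaces); for arbitrary probability spaces the claim fails, e.g. the shift on the integers with the trivial sigma-algebra and w = 1. *)

(* Defs.v *)
From HB Require Import structures.
From mathcomp Require Import all_boot all_order all_algebra.
From mathcomp Require Import all_classical all_reals all_analysis.
Import Order.TTheory GRing.Theory Num.Theory.
Import numFieldNormedType.Exports.

Set Implicit Arguments.
Unset Strict Implicit.
Unset Printing Implicit Defensive.

Local Open Scope classical_set_scope.
Local Open Scope ring_scope.
Local Open Scope ereal_scope.

Definition weak_Lnorm d (X : measurableType d) (R : realType)
    (mu : {measure set X -> \bar R}) (p : R) (f : X -> \bar R) : \bar R :=
  ereal_sup [set y%:E * mu [set x | y%:E <= `|f x|] `^ p^-1
            | y in [set y : R | (0 < y)%R]].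

Definition C_ (R : realType) (p : R) (w : nat -> R) : \bar R :=
  weak_Lnorm (@counting nat R) p (EFin \o w).

(* T is not required to be invertible. *)
Definition measure_preserving d (X : measurableType d) (R : realType)
    (P : probability X R) (T : X -> X) : Prop :=
  measurable_fun [set: X] T /\
  forall A : set X, measurable A -> P (T @^-1` A) = P A.

Definition aperiodic d (X : measurableType d) (R : realType)
    (P : probability X R) (T : X -> X) : Prop :=
  P.-negligible [set x | exists2 n : nat, (0 < n)%N & iter n T x = x].

(* Up to a null set, countably many measurable sets separate points. Every
   Lebesgue (standard) probability space, completed or not, has this property.
   Some such convention is needed to make pointwise aperiodicity meaningful:
   for the shift on the integers with the trivial sigma-algebra no point is
   periodic, yet every measurable function is constant and all the averages
   of f are equal to f. *)
Definition countably_separated d (X : measurableType d) (R : realType)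
    (P : probability X R) : Prop :=
  exists (A : nat -> set X) (N : set X),
    [/\ forall i, measurable (A i), P.-negligible N &
        forall x y, ~ N x -> ~ N y -> (forall i, A i x <-> A i y) -> x = y].

Definition dyadic_average d (X : measurableType d) (R : realType)
    (a : nat -> nat) (T : X -> X) (f : X -> R) (t : nat) (x : X) : R :=
  ((2 ^+ t)^-1 * \sum_(1 <= n < (2 ^ t).+1) f (iter (a n) T x))%R.

(* The notion for integer sequences, here for nonnegative ones, so that
   T ^ (a n) makes sense without an inverse of T. *)
Definition ultimately_bad (R : realType) (p : R) (a : nat -> nat) : Prop :=
  forall (d : measure_display) (X : measurableType d) (P : probability X R)
    (T : X -> X),
    countably_separated P -> measure_preserving P T -> aperiodic P T ->
  forall w : nat -> R, (forall t, (0 < w t)%R) -> C_ p w = +oo ->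
  ~ exists2 C : R, (0 < C)%R &
      forall f : X -> R, f \in Lfun P p%:E ->
        weak_Lnorm P p
          (fun x => ereal_sup
             (range (fun t => (w t * dyadic_average a T f t x)%:E)))
        <= C%:E * 'N[P]_p%:E[EFin \o f].

(* Main.v *)
Require Import Defs.
From mathcomp Require Import all_boot all_order all_algebra.
From mathcomp Require Import all_classical all_reals all_analysis.
From mathcomp Require Import measurable_realfun zify lra.

(** Why the theorem is true.

    Adding [k ^ n] to an integer increases its [n]-th base [k] digit by one and
    touches nothing else, unless that digit is [k - 1] and a carry occurs. Cut
    the digit positions into dyadic blocks, the block of [t] being the [n] with
    [2 ^ t / 2 < n <= 2 ^ t], which make up at least half of the times that
    enter the average at scale [t]. Hence the sum modulo [k] of the digits in
    block [t] goes up by one under [x |-> x + k ^ n] for a positive proportion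
    of the [n] in that average, while the digit sums of the other blocks stay
    put.

    Fix a finite set [S] of scales. Among the integers below a high power of
    [k], let [A] be the set of those whose digit sum is [1] modulo [k] in every
    block of [S], and let [G_t] be the set where the digit sum of block [t] is
    [0], those of the other blocks are [1], and at least half of the digits of
    block [t] are not [k - 1]. From a point of [G_t] at least a quarter of the
    moves [+ k ^ n], [n <= 2 ^ t], lead into [A]. The sets [G_t] are pairwise
    disjoint and each is at least half as large as [A], so the set where some
    average of the indicator of [A] over a scale in [S] is at least [1/4] is at
    least [|S| / 2] times as large as [A]. This is [lacunary_pattern].

    An aperiodic map of a countably separated space has, for each [H], a set
    [B] of positive measure whose first [H] preimages are disjoint from it
    ([aperiodic_disjoint_preimages]). All the levels of the resulting tower
    have the measure of [B], so the tower may be as small as it likes: only the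
    ratio of the numbers of levels matters. On this tower the dynamics is the
    translation of integers, and the pattern above gives an indicator function
    [f] whose maximal function, weighted by [w], is at least [y / 4] on a set
    of measure at least [|S| / 2] times that of the support of [f] as soon as
    [w_t >= y] on [S]. A weak type inequality with constant [C] would then give
    [y * |S| ^ (1/p) <= 8 * C] for all such [y] and [S], which is what [C_ p w
    = +oo] forbids ([many_large_weights]). *)

Set Implicit Arguments.
Unset Strict Implicit.
Unset Printing Implicit Defensive.
Import Order.TTheory GRing.Theory Num.Theory.

(** * Base expansions and digit sums over dyadic blocks *)

Local Open Scope ring_scope.

(** Digit positions are numbered from [0], so position [i] carries the weight
    [k ^ i.+1] and corresponds to the time [n = i.+1]. The blocks of scales [0]
    and [1] are the single positions [0] and [1]. *)
Definition dyadic_block (t i : nat) : bool := ((2 ^ t)./2 <= i < 2 ^ t)%N.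

Lemma dyadic_block_inj t s i :
  dyadic_block t i -> dyadic_block s i -> t = s.
Proof.
have lt_block a b : (a < b)%N -> dyadic_block a i -> dyadic_block b i -> False.
  move=> ab /andP[_ ia] /andP[bi _].
  have : (2 ^ a <= (2 ^ b)./2)%N.
    by case: b ab {bi} => // b ab; rewrite expnS mul2n doubleK leq_exp2l.
  lia.
by move=> ti si; case: (ltngtP t s) => // [ts|st];
  [case: (lt_block _ _ ts ti si) | case: (lt_block _ _ st si ti)].
Qed.

Lemma base_expansion_inj b q (f g : 'I_q -> nat) :
  (forall i, f i < b)%N -> (forall i, g i < b)%N ->
  (\sum_(i < q) f i * b ^ i.+1 = \sum_(i < q) g i * b ^ i.+1)%N -> f =1 g.
Proof.
elim: q f g => [|q IH] f g fb gb; first by move=> _ [].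
have shift (h : 'I_q.+1 -> nat) : (\sum_(i < q.+1) h i * b ^ i.+1 =
    (h ord0 + \sum_(i < q) h (lift ord0 i) * b ^ i.+1) * b)%N.
  rewrite big_ord_recl expn1 mulnDl big_distrl /=; congr (_ + _)%N.
  by apply: eq_bigr => i _; rewrite -mulnA -expnSr.
have low (h : 'I_q.+1 -> nat) : (h ord0 < b)%N ->
    ((h ord0 + \sum_(i < q) h (lift ord0 i) * b ^ i.+1) %% b = h ord0)%N.
  move=> hb; suff /eqP tail0 : (b %| \sum_(i < q) h (lift ord0 i) * b ^ i.+1)%N.
    by rewrite -modnDmr tail0 addn0 modn_small.
  by apply: dvdn_sum => i _; rewrite dvdn_mull // expnS dvdn_mulr.
have b0 : (0 < b)%N by apply: leq_ltn_trans (fb ord0).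
rewrite !shift => /eqP; rewrite eqn_pmul2r // => /eqP fg.
have fg0 : f ord0 = g ord0 by rewrite -(low f) ?fg ?low.
move: fg; rewrite fg0 => /addnI/IH fgS i.
by case: (unliftP ord0 i) => [j|] -> //; exact: fgS.
Qed.

Section DigitVectors.
Context (k q : nat).
Local Notation K := 'I_k.+2.
Local Notation V := {ffun 'I_q -> K}.
Implicit Types (v : V) (t s i n : nat) (S : seq nat).

Definition block_sum t v : K := \sum_(i < q | dyadic_block t i) v i.

Lemma block_sumD t v u : block_sum t (v + u) = block_sum t v + block_sum t u.
Proof. by rewrite -big_split; apply: eq_bigr => i _; rewrite ffunE. Qed.

Lemma sum_dyadic_block (M : nmodType) t (F : nat -> M) : (2 ^ t <= q)%N ->
  \sum_(i < q | dyadic_block t i) F i = \sum_((2 ^ t)./2 <= i < 2 ^ t) F i.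
Proof.
move=> tq; rewrite (big_nat_widen _ _ _ _ _ tq) (big_nat_widenl _ 0%N) //.
rewrite big_mkord.
by apply: eq_bigl => i; rewrite /dyadic_block andbC.
Qed.

Definition unit_digit (n : 'I_q) : V := [ffun i => (i == n)%:R].

Lemma block_sum_unit t (n : 'I_q) :
  block_sum t (unit_digit n) = (dyadic_block t n)%:R.
Proof.
rewrite /block_sum; case: (boolP (dyadic_block t n)) => tn; last first.
  rewrite big1 // => i ti; rewrite ffunE; case: eqP => // ein.
  by rewrite -ein ti in tn.
rewrite (bigD1 n) //= ffunE eqxx big1 ?addr0 // => i /andP[_ /negPf ni].
by rewrite ffunE ni.
Qed.

(** Adding this vector changes every digit of each block of scale at least [2]
    and preserves all block sums: the block consists of adjacent pairs, on which
    [1] and [-1] cancel. The one-digit blocks have to be left alone. *)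
Definition alternating : V :=
  [ffun i : 'I_q => if (i < 2)%N then 0 else (-1) ^+ i].

Lemma block_sum_alternating t : (2 ^ t <= q)%N -> block_sum t alternating = 0.
Proof.
move=> tq; pose F (i : nat) : K := if (i < 2)%N then 0 else (-1) ^+ i.
rewrite /block_sum (eq_bigr (fun i : 'I_q => F i)); last first.
  by move=> i _; rewrite ffunE.
rewrite sum_dyadic_block //.
case: t tq => [|[|t]] _.
- by rewrite big_nat1.
- by rewrite big_nat1.
have -> : ((2 ^ t.+2)./2 = 2 * 2 ^ t)%N by rewrite !expnS; lia.
have -> : (2 ^ t.+2 = 2 * (2 ^ t + 2 ^ t))%N by rewrite !expnS; lia.
have : (0 < 2 ^ t)%N by rewrite expn_gt0.
(* the left end and the length of the block vary independently from here on *)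
move: {1 2 3}(2 ^ t)%N => m m0; elim: (2 ^ t)%N => [|l IH].
  by rewrite addn0 big_geq.
have -> : (2 * (m + l.+1) = (2 * (m + l)).+2)%N by lia.
rewrite !big_nat_recr /= ?IH; try lia.
rewrite /F !ifF; try lia.
by rewrite add0r exprS mulN1r addrN.
Qed.

Definition balanced S : {set V} :=
  [set v | all (fun s => block_sum s v == 1) S].

Definition unbalanced_at S t : {set V} :=
  [set v | (block_sum t v == 0) &&
           all (fun s => (s == t) || (block_sum s v == 1)) S].

(** The top digit [k.+1] of base [k.+2] is [-1] in ['I_k.+2]; the other digits
    are those to which [1] can be added without a carry. *)
Definition free_digits t v : nat :=
  (\sum_(i < q | dyadic_block t i) (v i != -1%R))%N.

Definition promising S t : {set V} :=
  [set v in unbalanced_at S t | (2 ^ t <= 4 * free_digits t v)%N].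

Lemma balanced_add_unit S t v (n : 'I_q) :
  dyadic_block t n -> v \in unbalanced_at S t ->
  v + unit_digit n \in balanced S.
Proof.
move=> tn; rewrite !inE => /andP[/eqP vt /allP vS].
apply/allP => s /vS; rewrite block_sumD block_sum_unit.
case: eqP => [->|/eqP st] /=; first by rewrite vt tn add0r.
move=> /eqP ->; case: (boolP (dyadic_block s n)) => sn; last by rewrite addr0.
by rewrite (dyadic_block_inj sn tn) eqxx in st.
Qed.

(** The witness has digit [1] at the last position of each block and [0]
    elsewhere. *)
Lemma balanced_neq0 S :
  {in S, forall s, (2 ^ s <= q)%N} -> (0 < #|balanced S|)%N.
Proof.
move=> Sq; apply/card_gt0P.
exists [ffun i : 'I_q => (i.+1 == 2 ^ trunc_log 2 i.+1)%N%:R].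
rewrite inE; apply/allP => t tS; have tq := Sq t tS.
have t0 : (0 < 2 ^ t)%N by rewrite expn_gt0.
have nq : ((2 ^ t).-1 < q)%N by lia.
have last_block s : dyadic_block s (2 ^ s).-1.
  by rewrite /dyadic_block; have := expn_gt0 2 s; lia.
rewrite /block_sum (bigD1 (Ordinal nq)) //= ffunE /= prednK //.
rewrite trunc_expnK // eqxx.
rewrite big1 ?addr0 // => i /andP[ti /negP ni]; rewrite ffunE.
case: eqP => // ei; case: ni; rewrite -val_eqE /=.
have {}ei : i = (2 ^ trunc_log 2 i.+1).-1 :> nat by rewrite -ei.
move: (last_block (trunc_log 2 i.+1)); rewrite -ei => si.
by rewrite ei (dyadic_block_inj si ti).
Qed.

(** Subtracting the unit at a single position of block [t] embeds the first set
    into the second. *)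
Lemma leq_balanced_unbalanced S t : (2 ^ t <= q)%N -> t \in S ->
  (#|balanced S| <= #|unbalanced_at S t|)%N.
Proof.
move=> tq tS.
have t0 : (0 < 2 ^ t)%N by rewrite expn_gt0.
have nq : ((2 ^ t).-1 < q)%N by lia.
pose n := Ordinal nq.
have tn : dyadic_block t n by rewrite /dyadic_block /=; lia.
rewrite -(card_imset _ (addIr (- unit_digit n))) subset_leq_card //.
apply/fintype.subsetP => _ /imsetP[v vA ->]; move: vA; rewrite !inE => /allP vS.
have sub s :
    block_sum s (v - unit_digit n) = block_sum s v - (dyadic_block s n)%:R.
  apply: (addIr (block_sum s (unit_digit n))).
  by rewrite -block_sumD subrK block_sum_unit subrK.
rewrite sub tn (eqP (vS _ tS)) subrr eqxx /=.
apply/allP => s sS; rewrite sub; case: eqP => //= /eqP st.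
case: (boolP (dyadic_block s n)) => sn; last by rewrite subr0 vS.
by rewrite (dyadic_block_inj sn tn) eqxx in st.
Qed.

Lemma card_dyadic_block t : (2 ^ t <= q)%N ->
  (\sum_(i < q | dyadic_block t i) 1 = 2 ^ t - (2 ^ t)./2)%N.
Proof.
move=> tq.
by rewrite (sum_dyadic_block (fun=> 1%N)) // sum_nat_const_nat muln1.
Qed.

(** In a block of scale at least [2] a digit and its shift by [1] or [-1] cannot
    both be [-1], so one of the two vectors has at least half of its block free.
    A block of one digit is free since its sum, hence its digit, is [0]; this is
    why unbalanced blocks have sum [0] and balanced ones have sum [1]. *)
Lemma promising_alternating S t v :
  {in S, forall s, (2 ^ s <= q)%N} -> t \in S ->
  v \in unbalanced_at S t ->
  (v \in promising S t) || (v + alternating \in promising S t).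
Proof.
move=> Sq tS vU; have tq := Sq t tS.
have uU : v + alternating \in unbalanced_at S t.
  move: vU; rewrite !inE block_sumD block_sum_alternating // addr0.
  move=> /andP[-> /=].
  move=> /allP vS; apply/allP => s sS.
  by rewrite block_sumD block_sum_alternating ?Sq // addr0 vS.
rewrite inE vU inE uU /=.
have enough : (2 ^ t - (2 ^ t)./2 <=
    free_digits t v + free_digits t (v + alternating)%R)%N.
  have [t2|t2] := ltnP t 2.
    have half : ((2 ^ t)./2 = (2 ^ t).-1)%N.
      by case: t t2 {tq tS uU vU} => [|[]].
    have nq : ((2 ^ t).-1 < q)%N by have := expn_gt0 2 t; lia.
    have tP (i : 'I_q) : dyadic_block t i = (i == Ordinal nq).
      by rewrite -val_eqE /dyadic_block /= half; have := expn_gt0 2 t; lia.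
    have half1 : (2 ^ t - (2 ^ t)./2 = 1)%N by have := expn_gt0 2 t; lia.
    move: vU; rewrite inE => /andP[/eqP + _].
    rewrite half1 /block_sum /free_digits !(big_pred1 (Ordinal nq)) // => ->.
    by rewrite eq_sym oppr_eq0 oner_eq0.
  rewrite -card_dyadic_block // /free_digits -big_split /=.
  apply: leq_sum => i /andP[ti _]; rewrite !ffunE ifF; last first.
    case: t t2 ti {tS tq vU uU} => [|[|t]] // _.
    by rewrite !expnS; have := expn_gt0 2 t; lia.
  have [->|//] := eqVneq (v i) (-1).
  by rewrite -subr_eq0 addrAC subrr add0r signr_eq0.
lia.
Qed.

Lemma leq_unbalanced_promising S t :
  {in S, forall s, (2 ^ s <= q)%N} -> t \in S ->
  (#|unbalanced_at S t| <= 2 * #|promising S t|)%N.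
Proof.
move=> Sq tS; pose shift v := v - alternating.
have shift_inj : injective shift by exact: addIr.
have -> : (2 * #|promising S t| =
    #|promising S t| + #|shift @: promising S t|)%N.
  by rewrite card_imset // mul2n addnn.
apply: leq_trans (leq_card_setU _ _).
apply/subset_leq_card/fintype.subsetP => v vU.
rewrite inE; case/orP: (promising_alternating Sq tS vU) => [->//|vP].
apply/orP; right; apply/imsetP.
by exists (v + alternating); rewrite // /shift addrK.
Qed.

Lemma promising_disjoint S s t v : s \in S -> t \in S ->
  v \in promising S s -> v \in promising S t -> s = t.
Proof.
move=> sS tS; rewrite !inE.
move=> /andP[/andP[/eqP vs _] _] /andP[/andP[_ /allP vt] _].
by have := vt s sS; rewrite vs [_ == 1]eq_sym oner_eq0 orbF => /eqP.
Qed.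

Definition promising_any S : {set V} :=
  [set v | has (fun t => v \in promising S t) S].

Lemma leq_balanced_promising S : uniq S -> {in S, forall s, (2 ^ s <= q)%N} ->
  (size S * #|balanced S| <= 2 * #|promising_any S|)%N.
Proof.
move=> uS Sq.
have le_each t : t \in S -> (#|balanced S| <= 2 * #|promising S t|)%N.
  move=> tS; apply: leq_trans (leq_unbalanced_promising Sq tS).
  exact: leq_balanced_unbalanced (Sq _ tS) tS.
suff : forall r, uniq r -> {subset r <= S} ->
    (size r * #|balanced S| <=
     2 * #|[set v | has (fun t => v \in promising S t) r]|)%N.
  by apply.
elim=> [|t r IH] // /andP[tr ur] rS.
have tS : t \in S by rewrite rS ?mem_head.
have rS' : {subset r <= S} by move=> x xr; rewrite rS // inE xr orbT.
have -> : [set v | has (fun t => v \in promising S t) (t :: r)] =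
    promising S t :|: [set v | has (fun t => v \in promising S t) r].
  by apply/setP => v; rewrite 2![in RHS]inE inE.
rewrite cardsU (_ : _ :&: _ = finset.set0) ?cards0 ?subn0; last first.
  apply/setP => v; rewrite inE [in RHS]inE; apply/negP => /andP[vt].
  rewrite inE => /hasP[s sr vs]; move: tr.
  by rewrite (promising_disjoint tS (rS' _ sr) vt vs) sr.
by rewrite mulnDr mulSn leq_add ?le_each ?IH.
Qed.

Definition digit_value v : nat := (\sum_(i < q) v i * k.+2 ^ i.+1)%N.

Lemma digit_value_add_unit v (n : 'I_q) : v n != -1 ->
  digit_value (v + unit_digit n) = (digit_value v + k.+2 ^ n.+1)%N.
Proof.
move=> vn; rewrite /digit_value (bigD1 n) //= [in RHS](bigD1 n) //=.
have -> : (v + unit_digit n) n = (v n).+1 :> nat.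
  have next : val (v n + 1) = ((v n).+1 %% k.+2)%N by rewrite -[(v n).+1]addn1.
  rewrite !ffunE eqxx -[LHS]/(val (v n + 1)) next modn_small //.
  rewrite ltn_neqAle ltn_ord andbT.
  apply: contraNneq vn => vn; rewrite -subr_eq0 opprK; apply/eqP/val_inj.
  by rewrite next vn modnn.
rewrite mulSn -addnA addnC; congr (_ + _)%N; congr (_ + _)%N.
by apply: eq_bigr => i /negPf ni; rewrite !ffunE ni addr0.
Qed.

Lemma digit_value_inj : injective digit_value.
Proof.
move=> u v uv; apply/ffunP => i; apply/val_inj.
have ltK (w : V) j : (w j < k.+2)%N by exact: ltn_ord.
exact: (base_expansion_inj (ltK u) (ltK v) uv).
Qed.

End DigitVectors.

(** * The combinatorial pattern *)

(** [A] consists of the values of the balanced digit vectors, and [G] of the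
    values of the promising ones. The factors [2] and [4] come from keeping half
    of the unbalanced vectors, and half of the times in a block that is itself
    half of [1, 2 ^ t]. *)
Lemma lacunary_pattern (k : nat) (S : seq nat) : (2 <= k)%N -> uniq S ->
  exists A G : seq nat, [/\ uniq A, uniq G, (0 < size A)%N,
    (size S * size A <= 2 * size G)%N &
    {in G, forall j, exists2 t, t \in S &
      (2 ^ t <= 4 * \sum_(1 <= n < (2 ^ t).+1) (j + k ^ n \in A))%N}].
Proof.
case: k => [|[|k]] // _ uS.
pose q := (\sum_(s <- S) 2 ^ s)%N.
have Sq : {in S, forall s, (2 ^ s <= q)%N}.
  by move=> s sS; rewrite /q (big_rem s) //= leq_addr.
pose val := @digit_value k q.
exists [seq val v | v in balanced k q S],
  [seq val v | v in promising_any k q S].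
split.
- by rewrite map_inj_uniq ?enum_uniq //; exact: digit_value_inj.
- by rewrite map_inj_uniq ?enum_uniq //; exact: digit_value_inj.
- rewrite size_map -cardE; exact: balanced_neq0.
- by rewrite !size_map -!cardE leq_balanced_promising.
move=> _ /mapP[v + ->]; rewrite mem_enum inE => /hasP[t tS].
rewrite inE => /andP[vU vt]; exists t => //.
apply: leq_trans vt _; rewrite leq_mul2l /=.
rewrite big_add1 /= /free_digits.
pose hit (i : nat) : bool :=
  (digit_value v + k.+2 ^ i.+1)%N \in [seq val v | v in balanced k q S].
apply: (@leq_trans (\sum_(i < q | dyadic_block t i) hit i)%N).
  apply: leq_sum => i ti; case: eqVneq => //= vi; rewrite lt0b.
  apply/mapP; exists (v + unit_digit k i); last first.
    by rewrite /val digit_value_add_unit.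
  by rewrite mem_enum; exact: balanced_add_unit ti vU.
rewrite (sum_dyadic_block (fun i => hit i : nat)) ?Sq //.
rewrite [leqRHS](@big_cat_nat _ _ _ (2 ^ t)./2) //=; last by lia.
exact: leq_addl.
Qed.

(** * Towers over an aperiodic map *)

Local Open Scope classical_set_scope.
Local Open Scope ereal_scope.

Section Tower.
Context (d : measure_display) (X : measurableType d) (R : realType).
Context (P : probability X R) (T : X -> X).
Context (mpT : measure_preserving P T).

Lemma measurable_preimage_iter n (A : set X) :
  measurable A -> measurable (iter n T @^-1` A).
Proof.
have [mT _] := mpT.
elim: n A => [|n IH] A mA //.
have := mT measurableT _ mA; rewrite setTI; exact: IH.
Qed.

Lemma measure_preimage_iter n (A : set X) :
  measurable A -> P (iter n T @^-1` A) = P A.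
Proof.
have [mT PT] := mpT; elim: n A => [|n IH] A mA //.
have mTA : measurable (T @^-1` A) by rewrite -[_ @^-1` _]setTI; exact: mT.
by rewrite -(PT A mA) -(IH _ mTA).
Qed.

(** Induction on [H]. For almost every [x] in the set [B] obtained for [H], the
    point [iter H.+1 T x] differs from [x], so some set [A i] of the separating
    family contains exactly one of them. Countably many pieces of [B], indexed
    by [i] and by which of the two points is in [A i], thus cover [B] up to a
    null set; one of them has positive measure, and the iterate [iter H.+1 T]
    maps it off itself. *)
Lemma aperiodic_disjoint_preimages H :
  countably_separated P -> aperiodic P T -> exists2 B : set X,
  measurable B /\ 0 < P B &
  forall n x, (0 < n <= H)%N -> B x -> ~ B (iter n T x).
Proof.
move=> [A [N [mA [N' [mN' PN' NN']] sepA]]] [Q [mQ PQ perQ]].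
elim: H => [|H [B [mB PB] disjB]].
  by exists setT; [rewrite probability_setT; split | case].
pose side (b : bool) i := if b then A i else ~` A i.
pose cut b i := B `&` (side b i `\` (iter H.+1 T @^-1` side b i)).
have mcut b i : measurable (cut b i).
  have mside : measurable (side b i).
    by case: b => //; exact: measurableC.
  apply: measurableI => //; apply: measurableD => //.
  exact: measurable_preimage_iter.
have [[b [i Pi]]|null] := pselect (exists b i, 0 < P (cut b i)).
  exists (cut b i) => // n x nH1.
  have [->|nH] : n = H.+1 \/ (0 < n <= H)%N by lia.
    by move=> [_ [_ nAx]] [_ [Ax _]].
  by move=> [Bx _] [Bnx _]; exact: disjB nH Bx Bnx.
exfalso; move: PB; rewrite measure_negligible ?ltxx //.
have cut0 b i : P.-negligible (cut b i).
  apply/negligibleP => //; apply/eqP; rewrite -measure_le0 leNgt.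
  by apply/negP => Pi; apply: null; exists b, i.
have N0 : P.-negligible N' by exact/negligibleP.
have TN0 : P.-negligible (iter H.+1 T @^-1` N').
  apply/negligibleP; first exact: measurable_preimage_iter.
  exact: etrans (measure_preimage_iter _ mN') PN'.
apply: (@negligibleS _ _ _ _ ((Q `|` (N' `|` iter H.+1 T @^-1` N')) `|`
    ((\bigcup_i cut true i) `|` (\bigcup_i cut false i)))); last first.
  apply: negligibleU.
    by apply: negligibleU; [exact/negligibleP | exact: negligibleU].
  by apply: negligibleU; apply: negligible_bigcup => i; exact: cut0.
move=> x Bx; apply: contrapT.
move=> /not_orP[/not_orP[Qx /not_orP[Nx NTx]] /not_orP[cutt cutf]].
apply: Qx; apply: perQ; exists H.+1 => //.
apply: sepA => [/NN'//|/NN'//|i]; split => [Ax|Ax]; apply: contrapT => nAx.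
- by apply: cutf; exists i => //; split => //; split => // /(_ Ax).
- by apply: cutt; exists i => //; split => //; split.
Qed.

(** The levels are numbered so that [T] goes up by one: the top level [H] is
    [B], and level [j] reaches it after [H - j] steps. *)
Definition level (B : set X) H j : set X := iter (H - j) T @^-1` B.

Lemma measurable_level B H j : measurable B -> measurable (level B H j).
Proof. exact: measurable_preimage_iter. Qed.

Lemma level_shift B H j m x : (j + m <= H)%N ->
  level B H j x -> level B H (j + m) (iter m T x).
Proof.
rewrite /level /= -iterD => jm.
by rewrite (_ : (H - (j + m) + m)%N = (H - j)%N) //; lia.
Qed.

Section Levels.
Context (B : set X) (H : nat) (mB : measurable B).
Context (disjB : forall n x, (0 < n <= H)%N -> B x -> ~ B (iter n T x)).

Lemma level_disjoint i j x : (i <= H)%N -> (j <= H)%N ->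
  level B H i x -> level B H j x -> i = j.
Proof.
have lt_false a b y : (a < b <= H)%N -> level B H a y -> ~ level B H b y.
  move=> ab ya yb; apply: (disjB (n := b - a) _ yb); first by lia.
  by rewrite -iterD (_ : (b - a + (H - b))%N = (H - a)%N) //; lia.
move=> iH jH xi xj; case: (ltngtP i j) => // ij.
  by case: (lt_false i j x) => //; rewrite ij.
by case: (lt_false j i x) => //; rewrite ij.
Qed.

Lemma measure_levels (s : seq nat) : uniq s -> {in s, forall j, (j <= H)%N} ->
  P (\bigcup_(j in [set` s]) level B H j) = (fine (P B) *+ size s)%:E.
Proof.
move=> us sH; rewrite (measure_fin_bigcup _ (finite_seq s)).
- rewrite -fsbig_seq //.
  rewrite (eq_bigr (fun=> (fine (P B))%:E)); last first.
    move=> j _.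
    by rewrite fineK ?fin_num_measure // -(measure_preimage_iter (H - j) mB).
  by rewrite sumEFin big_const_seq count_predT iter_addr_0.
- move=> i j /sH iH /sH jH [x [xi xj]]; exact: level_disjoint xi xj.
- by move=> j _; exact: measurable_level.
Qed.

End Levels.
End Tower.

(** * Weak norms, indicators and maximal functions *)

(** When infinitely many weights are at least [y], a finite part of them, large
    enough for [M], is selected. *)
Lemma many_large_weights (R : realType) (p : R) (w : nat -> R) (M : R) :
  (0 < p)%R -> (forall t, 0 < w t)%R -> C_ p w = +oo ->
  exists (y : R) (S : seq nat), [/\ (0 < y)%R, uniq S,
    {in S, forall t, (y <= w t)%R} & (M < y * (size S)%:R `^ p^-1)%R].
Proof.
move=> p0 w0 Cw.
have /ereal_sup_gt[_ [y y0 <-]] : M%:E < C_ p w by rewrite Cw ltry.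
have large t : [set x | y%:E <= `|(EFin \o w) x|] t -> (y <= w t)%R.
  by rewrite /= lee_fin gtr0_norm.
rewrite /= /counting; case: asboolP => [fin|inf].
  rewrite poweR_EFin -EFinM lte_fin => My.
  eexists y, _; split; [by [] | | | exact: My]; first exact: finmap.fset_uniq.
  by move=> t; rewrite in_fset_set // inE; exact: large.
move=> _; pose z := ((`|M| + 1) / y)%R.
have z0 : (0 <= z)%R by rewrite divr_ge0 ?addr_ge0 // ltW.
have [S SL nS] := infinite_set_fset (Num.truncn (z `^ p)%R).+1 inf.
exists y, (finmap.enum_fset S); split=> //; first exact: finmap.fset_uniq.
  by move=> t /SL/large.
rewrite mulrC -ltr_pdivrMr //; apply: (@lt_le_trans _ _ z).
  rewrite ltr_pM2r ?invr_gt0 //; apply: le_lt_trans (ler_norm M) _.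
  by rewrite ltrDl.
have zE : z = ((z `^ p) `^ p^-1)%R.
  by rewrite -powRrM mulfV ?lt0r_neq0 // powRr1.
rewrite [leLHS]zE ge0_ler_powR ?nnegrE ?powR_ge0 ?invr_ge0 ?(ltW p0) //.
by apply: le_trans (ltW (truncnS_gt _)) _; rewrite ler_nat.
Qed.

Lemma Lnorm_indic d (X : measurableType d) (R : realType)
    (P : probability X R) (p : R) (A : set X) :
  (p != 0)%R -> measurable A -> 'N[P]_p%:E[EFin \o \1_A] = P A `^ p^-1.
Proof.
move=> p0 mA; rewrite unlock; congr (_ `^ _).
rewrite -[A in RHS]setIT -integral_indic //; apply: eq_integral => x _ /=.
by rewrite indicE; case: (_ \in _); rewrite ?normr1 ?powR1 // normr0 powR0.
Qed.

Lemma measurable_dyadic_average d (X : measurableType d) (R : realType)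
    (T : X -> X) (a : nat -> nat) (f : X -> R) t :
  measurable_fun [set: X] T -> measurable_fun [set: X] f ->
  measurable_fun [set: X] (dyadic_average a T f t).
Proof.
move=> mT mf; apply: measurable_funM => //; apply: measurable_sum => n.
apply: (measurableT_comp mf).
elim: (a n) => [|m IH]; first exact: measurable_id.
exact: (measurableT_comp mT).
Qed.

Lemma measurable_sup_range d (X : measurableType d) (R : realType)
    (h : nat -> X -> \bar R) :
  (forall t, measurable_fun [set: X] (h t)) ->
  measurable_fun [set: X] (fun x => ereal_sup (range (h ^~ x))).
Proof.
move=> mh.
rewrite (_ : (fun x => _) = (fun x => esups (h ^~ x) 0%N)); last first.
  apply/funext => x; congr ereal_sup.
  by apply/seteqP; split => [_ [t _ <-]|_ [t _ <-]]; exists t.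
exact: measurable_fun_esups.
Qed.

(** * Ultimate badness of the powers *)

Theorem theorem6p2 (R : realType) (k : nat) (p : R) (hk : (2 <= k)%N)
    (hp : (1 < p)%R) :
  ultimately_bad p (fun n => (k ^ n)%N).
Proof.
move=> d X P T sepP mpT apT w w0 Cw [C C0 weak_bound].
have p0 : (0 < p)%R by exact: lt_trans hp.
(* [8 = 4 * 2]: the averages reach [1/4], and [2] bounds [2 `^ p^-1] *)
have [y [S [y0 uS wS big]]] := many_large_weights (8 * C)%R p0 w0 Cw.
have [A [G [uA uG A0 SAG hitG]]] := lacunary_pattern hk uS.
pose H := (\max_(j <- A ++ G) j)%N.
have AH : {in A, forall j, (j <= H)%N}.
  move=> j jA; apply: (@leq_bigmax_seq _ (A ++ G) predT id) => //.
  by rewrite mem_cat jA.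
have GH : {in G, forall j, (j <= H)%N}.
  move=> j jG; apply: (@leq_bigmax_seq _ (A ++ G) predT id) => //.
  by rewrite mem_cat jG orbT.
have [B [mB PB] disjB] := aperiodic_disjoint_preimages mpT H sepP apT.
pose UA := \bigcup_(j in [set` A]) level T B H j.
pose UG := \bigcup_(j in [set` G]) level T B H j.
have mU (s : seq nat) : measurable (\bigcup_(j in [set` s]) level T B H j).
  apply: fin_bigcup_measurable => [|j _]; first exact: finite_seq.
  exact: (measurable_level mpT H j mB).
pose f : X -> R := \1_UA.
have mf : measurable_fun [set: X] f.
  by apply: measurable_indic; exact: mU.
have PUA := measure_levels mpT mB disjB uA AH.
have PUG := measure_levels mpT mB disjB uG GH.
have normf : 'N[P]_p%:E[EFin \o f] = P UA `^ p^-1.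
  by rewrite Lnorm_indic ?gt_eqF //; exact: mU.
have fL : f \in Lfun P p%:E.
  rewrite inE; apply/andP; split; rewrite inE //=.
  by rewrite /finite_norm normf PUA poweR_EFin ltry.
pose avg := dyadic_average (fun n => (k ^ n)%N) T f.
have large_sup x : UG x ->
    (y / 4)%:E <= ereal_sup (range (fun t => (w t * avg t x)%:E)).
  move=> [j jG xj]; have [t tS hit] := hitG j jG.
  apply: le_ereal_sup_tmp; exists (w t * avg t x)%:E; first by exists t.
  rewrite lee_fin ler_pM ?(ltW y0) ?invr_ge0 ?wS //.
  rewrite /avg /dyadic_average mulrC ler_pdivlMr ?exprn_gt0 //.
  apply: (@le_trans _ _
      (\sum_(1 <= n < (2 ^ t).+1) (j + k ^ n \in A) : nat)%:R%R).
    by rewrite ler_pdivrMl // -natrX -natrM ler_nat.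
  rewrite natr_sum; apply: ler_sum => n _.
  rewrite /f indicE; case jnA : (_ \in A); last by rewrite ler0n.
  rewrite (_ : (_ \in UA) = true) //; apply/mem_set.
  exists (j + k ^ n)%N => //=.
  by apply: level_shift => //; exact: AH.
have := weak_bound f fL; rewrite normf PUA.
set F := (fun x => ereal_sup _) => weakF.
have mF : measurable_fun [set: X] F.
  apply: measurable_sup_range => t; apply/measurable_EFinP.
  apply: measurable_funM => //.
  by apply: measurable_dyadic_average => //; case: mpT.
have : (y / 4)%:E * P UG `^ p^-1 <= C%:E * (fine (P B) *+ size A)%:E `^ p^-1.
  apply: le_trans weakF; apply: le_ereal_sup_tmp.
  exists ((y / 4)%:E * P [set x | (y / 4)%:E <= `|F x|] `^ p^-1).
    by exists (y / 4)%R => //=; rewrite divr_gt0.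
  rewrite lee_wpmul2l ?lee_fin ?divr_ge0 ?(ltW y0) //.
  have mFy : measurable [set x | (y / 4)%:E <= `|F x|].
    rewrite -[X in measurable X]setTI; apply: emeasurable_fun_c_infty => //.
    exact: measurableT_comp.
  rewrite gt0_ler_poweR ?invr_ge0 ?(ltW p0) ?in_itv ?andbT //=
    ?measure_ge0 ?leey //.
  rewrite le_measure ?inE //; first exact: mU.
  by move=> x /large_sup Fx; exact: le_trans Fx (lee_abs _).
rewrite PUG !poweR_EFin -!EFinM lee_fin.
set b := fine (P B) => bound.
have b0 : (0 < b)%R by rewrite fine_gt0 // PB ltey_eq fin_num_measure.
have a0 : (0 < (b *+ size A) `^ p^-1)%R by rewrite powR_gt0 // pmulrn_lgt0.
have transfer : ((b *+ size A) `^ p^-1 * (size S)%:R `^ p^-1 <=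
    2 * (b *+ size G) `^ p^-1)%R.
  rewrite -powRM ?mulrn_wge0 ?(ltW b0) //.
  apply: (@le_trans _ _ ((2 * (b *+ size G)) `^ p^-1)%R).
    rewrite ge0_ler_powR ?nnegrE ?invr_ge0 ?(ltW p0) ?mulr_ge0 ?mulrn_wge0
      ?(ltW b0) //.
    rewrite -[(b *+ size A)%R]mulr_natr -[(b *+ size G)%R]mulr_natr.
    rewrite mulrCA -mulrA ler_pM2l // -!natrM ler_nat.
    by rewrite mulnC.
  rewrite powRM ?mulrn_wge0 ?(ltW b0) // ler_wpM2r ?powR_ge0 //.
  rewrite -[leRHS]powRr1 // ler_powR ?ler1n // invf_le1 //; exact: ltW.
move: bound transfer big a0.
move: ((b *+ size A) `^ p^-1)%R ((b *+ size G) `^ p^-1)%R.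
move: ((size S)%:R `^ p^-1)%R => n u v.
by move=> uv un yn u0; nra.
Qed.
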